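(* Let $\mathcal{G}=(B,\psi,A)$ be a directed quantum graph such that $\psi$ is a $\delta$-form and $A$ is completely positive, and let $E_{\mathcal{G}}$ be the quantum edge correspondence. Then $$\{x\in B: x\cdot\xi=0\ \ \forall \xi\in E_{\mathcal{G}}\}=\left(BA^*(B)B\right)^{\perp}$$ and $$\overline{\mathrm{span}}\,\langle E_{\mathcal{G}},E_{\mathcal{G}}\rangle_B=B\cdot A(B)\cdot B,$$ the two-sided ideal of $B$ generated by the range of $A$. In particular, $E_{\mathcal{G}}$ is faithful if and only if $\ker(A)$ does not contain a central summand of $B$, and $E_{\mathcal{G}}$ is full if and only if $A(B)$ is not orthogonal to a central summand of $B$.
   Context: A directed quantum graph $\mathcal{G}=(B,\psi,A)$ consists of a finite-dimensional C*-algebra $B$, a faithful state $\psi$ on $B$ and a linear map $A\colon B\to B$, as follows. Let $m\colon B\otimes B\to B$ be multiplication and $m^*\colon B\to B\otimes B$ its adjoint with respect to the inner products $\langle x,y\rangle_\psi=\psi(x^*y)$ on $B$ and $\langle\cdot,\cdot\rangle_{\psi\otimes\psi}$ on $B\otimes B$. The state $\psi$ is a $\delta$-form ($\delta>0$) if $mm^*=\delta^2\,\mathrm{id}_B$, and $A$ is a quantum adjacency matrix if $m(A\otimes A)m^*=\delta^2A$. $A^*$ is the adjoint of $A$, and orthogonality and $\perp$ are taken, with respect to $\langle\cdot,\cdot\rangle_\psi$. $BA^*(B)B$ and $B\cdot A(B)\cdot B$ denote the linear spans of the respective products (two-sided ideals). A central summand of $B$ is a nonzero direct summand $zB$ with $z$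 a central projection. $B\otimes_\psi B$ is the C*-correspondence over $B$ (right Hilbert $B$-module with a left action of $B$ by adjointable operators) with underlying space $B\otimes B$, actions $x\cdot(a\otimes b)\cdot y=(xa)\otimes(by)$ and inner product $\langle a\otimes b,c\otimes d\rangle_B=b^*\psi(a^*c)d$. The quantum edge indicator is $\epsilon_{\mathcal{G}}=\frac{1}{\delta^2}(\mathrm{id}\otimes A)m^*(1_B)\in B\otimes_\psi B$, and the quantum edge correspondence is the subcorrespondence $E_{\mathcal{G}}=\mathrm{span}\{x\cdot\epsilon_{\mathcal{G}}\cdot y: x,y\in B\}$. A C*-correspondence $X$ over $B$ is faithful if its left action $B\to\mathcal{L}(X)$ is injective, and full if $\overline{\mathrm{span}}\,\langle X,X\rangle_B=B$. *)

(* Defs.v *)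
From HB Require Import structures.
From mathcomp Require Import all_boot all_order all_algebra all_field.
From mathcomp Require Import boolp classical_sets reals.
From mathcomp Require Import complex.

Set Implicit Arguments.
Unset Strict Implicit.
Unset Printing Implicit Defensive.

Import Order.TTheory GRing.Theory Num.Theory.
Local Open Scope classical_set_scope.
Local Open Scope complex_scope.
Local Open Scope ring_scope.

(* A [falgType] is unital with [1 != 0]; this excludes only the zero algebra,
   which carries no state. Completeness of the norm is automatic in finite
   dimension. *)
HB.mixin Record Falgebra_isCStar (R : realType) B of Falgebra R[i] B := {
  star : B -> B;
  starK : involutive star;
  starD : forall x y, star (x + y) = star x + star y;
  starZ : forall (a : R[i]) x, star (a *: x) = a^*%C *: star x;
  starM : forall x y, star (x * y) = star y * star x;
  cnorm : B -> R;
  cnorm0_eq0 : forall x, cnorm x = 0 -> x = 0;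
  cnormD : forall x y, cnorm (x + y) <= cnorm x + cnorm y;
  cnormZ : forall (a : R[i]) x, cnorm (a *: x) = complex.Re `|a| * cnorm x;
  cnormM : forall x y, cnorm (x * y) <= cnorm x * cnorm y;
  cnorm_starM : forall x, cnorm (star x * x) = cnorm x ^+ 2
}.

#[short(type="fdCStarType")]
HB.structure Definition FdCStar (R : realType) :=
  { B of Falgebra R[i] B & Falgebra_isCStar R B }.

Section Tensor.
Variable K : fieldType.
Implicit Types U V W : vectType K.

(* The matrix [t] stands for the sum of the [t i j] e_i (x) e_j, where e_i and
   e_j are the standard bases of [U] and [V]. *)
Definition tensor U V : vectType K := 'M[K]_(\dim {:U}, \dim {:V}).

Definition bvec U (i : 'I_(\dim {:U})) : U := (vbasis {:U})`_i.

Definition bcoord U (u : U) (i : 'I_(\dim {:U})) : K := coord (vbasis {:U}) i u.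

Definition tens U V (u : U) (v : V) : tensor U V :=
  \matrix_(i, j) (bcoord u i * bcoord v j).

Definition tlift U V W (f : U -> V -> W) : 'Hom(tensor U V, W) :=
  linfun (fun t : tensor U V => \sum_i \sum_j t i j *: f (bvec i) (bvec j)).

Definition tmap U V U' V' (f : 'Hom(U, U')) (g : 'Hom(V, V')) :
  'Hom(tensor U V, tensor U' V') := tlift (fun u v => tens (f u) (g v)).

Lemma linfun_funE U V (f : U -> V) : linear f -> linfun f =1 f.
Proof.
move=> linf u.
pose F : {linear U -> V} := HB.pack f (GRing.isLinear.Build K U V *:%R f linf).
exact: (lfunE F).
Qed.

Lemma bvec_expand U (u : U) : u = \sum_i bcoord u i *: bvec i.
Proof. exact/coord_vbasis/memvf. Qed.

Lemma linear_expand U V (f : U -> V) : linear f ->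
  forall u, f u = \sum_i bcoord u i *: f (bvec i).
Proof.
move=> linf u; rewrite -(linfun_funE linf u) {1}[u]bvec_expand linear_sum.
by apply: eq_bigr => i _; rewrite linearZ /= linfun_funE.
Qed.

Lemma tliftS U V W (f : U -> V -> W) (t : tensor U V) :
  tlift f t = \sum_i \sum_j t i j *: f (bvec i) (bvec j).
Proof.
rewrite /tlift linfun_funE // => a x y.
rewrite scaler_sumr -big_split; apply: eq_bigr => i _ /=.
rewrite scaler_sumr -big_split; apply: eq_bigr => j _ /=.
by rewrite !mxE scalerDl scalerA.
Qed.

(* The universal property of the tensor product. *)
Lemma tliftE U V W (f : U -> V -> W) (u : U) (v : V) :
  (forall v, linear (f^~ v)) -> (forall u, linear (f u)) ->
  tlift f (tens u v) = f u v.
Proof.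
move=> linl linr; rewrite tliftS (linear_expand (linl v)).
apply: eq_bigr => i _; rewrite (linear_expand (linr _)) scaler_sumr.
by apply: eq_bigr => j _; rewrite mxE scalerA.
Qed.

Lemma tens_expand U V (t : tensor U V) :
  t = \sum_i \sum_j t i j *: tens (bvec i) (bvec j).
Proof.
have bE W (i k : 'I_(\dim {:W})) : bcoord (bvec i : W) k = (i == k)%:R.
  by rewrite /bcoord /bvec coord_free ?(basis_free (vbasisP _)).
apply/matrixP => i j; rewrite summxE (bigD1 i) //= summxE (bigD1 j) //=.
rewrite !mxE !bE !eqxx !mulr1 big1 ?addr0 => [|k kj]; last first.
  by rewrite !mxE !bE (negPf kj) !mulr0.
rewrite big1 ?addr0 // => k ki; rewrite summxE big1 // => l _.
by rewrite !mxE !bE (negPf ki) mul0r mulr0.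
Qed.

End Tensor.

Section Sesquilinear.
Variable R : realType.
Local Notation C := R[i].

(* The sesquilinear extension of [h], conjugate-linear in the first tensor. *)
Definition tsesq (U V W : vectType C) (h : U -> V -> U -> V -> W)
    (s t : tensor U V) : W :=
  \sum_i \sum_j \sum_k \sum_l
    ((s i j)^*%C * t k l) *: h (bvec i) (bvec j) (bvec k) (bvec l).

Definition is_adjoint (U V : vectType C) (ipU : U -> U -> C) (ipV : V -> V -> C)
    (f : 'Hom(U, V)) (g : 'Hom(V, U)) : Prop :=
  forall u v, ipV (f u) v = ipU u (g v).

(* The default value 0 is only returned when no adjoint exists; for the inner
   products of a faithful state see [adj1P] and [adjmP] below. *)
Definition adjoint (U V : vectType C) (ipU : U -> U -> C) (ipV : V -> V -> C)
    (f : 'Hom(U, V)) : 'Hom(V, U) :=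
  xget 0 [set g | is_adjoint ipU ipV f g].

Definition span_set (V : vectType C) (S : set V) : set V :=
  [set v | exists n (c : 'I_n -> C) (s : 'I_n -> V),
     (forall i, S (s i)) /\ v = \sum_i c i *: s i].

Lemma tsesqE (U V W : vectType C) (h : U -> V -> U -> V -> W)
    (a c : U) (b d : V) :
  (forall l x y b c d, h (l *: x + y) b c d = l^*%C *: h x b c d + h y b c d) ->
  (forall a l x y c d, h a (l *: x + y) c d = l^*%C *: h a x c d + h a y c d) ->
  (forall a b d, linear (fun c => h a b c d)) ->
  (forall a b c, linear (h a b c)) ->
  tsesq h (tens a b) (tens c d) = h a b c d.
Proof.
move=> ha hb hc hd.
have conj_expand (X : vectType C) (f : X -> W) :
    (forall l x y, f (l *: x + y) = l^*%C *: f x + f y) ->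
    forall x, f x = \sum_i (bcoord x i)^*%C *: f (bvec i).
  move=> hf x; rewrite {1}[x]bvec_expand.
  have f0 : f 0 = 0.
    by have /eqP := hf 1 0 0; rewrite rmorph1 !scale1r addr0 -subr_eq0
      opprD addNKr oppr_eq0 => /eqP.
  elim/big_rec2: _ => [//|i y1 y2 _ IH].
  by rewrite hf IH.
rewrite (conj_expand _ (fun a => h a b c d)) //.
apply: eq_bigr => i _; rewrite (conj_expand _ (fun b => h _ b c d)) // scaler_sumr.
apply: eq_bigr => j _.
rewrite (linear_expand (hc (bvec i) (bvec j) d)) scaler_sumr scaler_sumr.
apply: eq_bigr => k _; rewrite (linear_expand (hd _ _ _)) !scaler_sumr.
apply: eq_bigr => l _; rewrite !mxE !scalerA; congr (_ *: _).
by rewrite rmorphM /= !mulrA.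
Qed.

Lemma adjoint_exists (U V : vectType C) (ipU : U -> U -> C) (ipV : V -> V -> C)
    (f : 'Hom(U, V)) :
  (forall v a x y, ipU v (a *: x + y) = a * ipU v x + ipU v y) ->
  (forall v a x y, ipU (a *: x + y) v = a^*%C * ipU x v + ipU y v) ->
  (forall v a x y, ipV v (a *: x + y) = a * ipV v x + ipV v y) ->
  (forall v a x y, ipV (a *: x + y) v = a^*%C * ipV x v + ipV y v) ->
  (forall x, (forall u, ipU u x = 0) -> x = 0) ->
  is_adjoint ipU ipV f (adjoint ipU ipV f).
Proof.
move=> linU cU linV cV nondeg.
suff [g gP] : exists g, is_adjoint ipU ipV f g by exact: (xgetPex 0 (ex_intro _ g gP)).
pose n := \dim {:U}.
pose Phi : 'Hom(U, 'rV[C]_n) := linfun (fun w : U => \row_i ipU (bvec i) w).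
pose Psi : 'Hom(V, 'rV[C]_n) := linfun (fun v : V => \row_i ipV (f (bvec i)) v).
have PhiE w : Phi w = \row_i ipU (bvec i) w.
  by rewrite linfun_funE // => a x y; apply/rowP => i; rewrite !mxE linU.
have PsiE w : Psi w = \row_i ipV (f (bvec i)) w.
  by rewrite linfun_funE // => a x y; apply/rowP => i; rewrite !mxE linV.
have cexp (X : vectType C) (F : U -> C) :
    (forall a x y, F (a *: x + y) = a^*%C * F x + F y) ->
    forall x, F x = \sum_i (bcoord x i)^*%C * F (bvec i).
  move=> hF x; rewrite {1}[x]bvec_expand.
  have F0 : F 0 = 0.
    by have /eqP := hF 1 0 0; rewrite rmorph1 scale1r mul1r addr0 -subr_eq0
      opprD addNKr oppr_eq0 => /eqP.
  by elim/big_rec2: _ => [//|i y1 y2 _ IH]; rewrite hF IH.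
have Phi_inj : lker Phi == 0%VS.
  rewrite -subv0; apply/subvP => w; rewrite memv_ker memv0 PhiE => /eqP w0.
  apply/eqP/nondeg => u; rewrite (cexp U (ipU^~ w)) ?big1 // => i _.
  by have /rowP/(_ i) := w0; rewrite !mxE => ->; rewrite mulr0.
have Phi_surj : limg Phi = fullv.
  apply/eqP; rewrite eqEdim subvf /=.
  have -> : \dim {:'rV[C]_n} = n by rewrite dimvf /dim /= mul1n.
  have := limg_ker_dim Phi fullv; rewrite (eqP Phi_inj) capv0 dimv0 add0n => ->.
  exact: leqnn.
exists (Phi^-1 \o Psi)%VF => u v.
have /rowP E : Phi ((Phi^-1 \o Psi)%VF v) = Psi v.
  by rewrite comp_lfunE limg_lfunVK // Phi_surj memvf.
rewrite (cexp U (ipU^~ _)) // (cexp U (fun u => ipV (f u) v)); last first.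
  by move=> a x y; rewrite linearP cV.
by apply: eq_bigr => i _; have := E i; rewrite PhiE PsiE !mxE => ->.
Qed.

End Sesquilinear.

Section QuantumGraph.
Variables (R : realType) (B : fdCStarType R).
Local Notation C := R[i].
Local Notation BB := (tensor B B).

Definition cnorm_closure (S : set B) : set B :=
  [set x | forall e : R, 0 < e -> exists2 y, S y & cnorm (x - y) < e].

(* In a C*-algebra, and in the C*-algebra of matrices below, the positive
   elements are exactly those of the form y^* y. *)
Definition positive (x : B) : Prop := exists y : B, x = star y * y.

Definition adjmx n (X : 'M[B]_n) : 'M[B]_n := \matrix_(i, j) star (X j i).

Definition positive_mx n (X : 'M[B]_n) : Prop :=
  exists Y : 'M[B]_n, X = adjmx Y *m Y.

Definition completely_positive (A : 'End(B)) : Prop :=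
  forall n (X : 'M[B]_n), positive_mx X -> positive_mx (map_mx A X).

Definition central_projection (z : B) : Prop :=
  [/\ star z = z, z * z = z & forall b, z * b = b * z].

Definition central_summand (S : set B) : Prop :=
  exists z : B, [/\ central_projection z, z != 0 & S = [set z * b | b in setT]].

Definition mulT : 'Hom(BB, B) := tlift (fun a b : B => a * b).

Definition state (psi : {scalar B}) : Prop :=
  (forall x, positive x -> 0 <= psi x) /\ psi 1 = 1.

Definition faithful_state (psi : {scalar B}) : Prop :=
  state psi /\ forall x, psi (star x * x) = 0 -> x = 0.

Lemma mulTE a b : mulT (tens a b) = a * b.
Proof.
rewrite /mulT tliftE // => [v|u] l x y.
- by rewrite mulrDl -scalerAl.
- by rewrite mulrDr -scalerAr.
Qed.

Section State.
Variable psi : {scalar B}.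

Definition ip (x y : B) : C := psi (star x * y).

Definition ip2 : BB -> BB -> C :=
  tsesq (fun a b c d : B => ip a c * ip b d : C^o).

Lemma ipDl v a x y : ip (a *: x + y) v = a^*%C * ip x v + ip y v.
Proof. by rewrite /ip starD starZ mulrDl -scalerAl linearP. Qed.

Lemma ipDr v a x y : ip v (a *: x + y) = a * ip v x + ip v y.
Proof. by rewrite /ip mulrDr -scalerAr linearP. Qed.

Lemma ip2E a b c d : ip2 (tens a b) (tens c d) = ip a c * ip b d.
Proof.
rewrite /ip2 tsesqE // => [l x y b' c' d'|a' l x y c' d'|a' b' d' l x y
  |a' b' c' l x y].
- by rewrite ipDl mulrDl -mulrA.
- by rewrite ipDl mulrDr mulrCA.
- by rewrite ipDr mulrDl -mulrA.
- by rewrite ipDr mulrDr mulrCA.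
Qed.

Definition orthogonal_set (S : set B) : set B :=
  [set x | forall y, S y -> ip y x = 0].

Definition mulT_adj : 'Hom(B, BB) := adjoint ip2 ip mulT.

Definition adj (A : 'End(B)) : 'End(B) := adjoint ip ip A.

Lemma ip_nondegenerate x : faithful_state psi -> (forall u, ip u x = 0) -> x = 0.
Proof. by move=> [_ psi0] /(_ x) /psi0. Qed.

Lemma ip2Dl v a x y : ip2 (a *: x + y) v = a^*%C * ip2 x v + ip2 y v.
Proof.
rewrite /ip2 /tsesq mulr_sumr -big_split; apply: eq_bigr => i _ /=.
rewrite mulr_sumr -big_split; apply: eq_bigr => j _ /=.
rewrite mulr_sumr -big_split; apply: eq_bigr => k _ /=.
rewrite mulr_sumr -big_split; apply: eq_bigr => l _ /=.
by rewrite !mxE rmorphD rmorphM /= mulrDl scalerDl -mulrA -scalerA.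
Qed.

Lemma ip2Dr v a x y : ip2 v (a *: x + y) = a * ip2 v x + ip2 v y.
Proof.
rewrite /ip2 /tsesq mulr_sumr -big_split; apply: eq_bigr => i _ /=.
rewrite mulr_sumr -big_split; apply: eq_bigr => j _ /=.
rewrite mulr_sumr -big_split; apply: eq_bigr => k _ /=.
rewrite mulr_sumr -big_split; apply: eq_bigr => l _ /=.
rewrite !mxE -[RHS]/(a * (_ * _ * _) + _ * _ * _) -[LHS]/(_ * (a * _ + _) * _).
by rewrite mulrDr mulrDl !mulrA (mulrC _ a).
Qed.

Lemma ip_sumr (I : finType) (F : I -> B) (c : I -> C) x :
  ip x (\sum_i c i *: F i) = \sum_i c i * ip x (F i).
Proof.
by rewrite /ip mulr_sumr linear_sum; apply: eq_bigr => i _; rewrite -scalerAr linearZ.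
Qed.

Lemma ip2_tensl a b (t : BB) :
  ip2 (tens a b) t = \sum_i \sum_j t i j * (ip a (bvec i) * ip b (bvec j)).
Proof.
have lin : linear (ip2 (tens a b) : BB -> C^o) by move=> l x y; exact: ip2Dr.
pose F : {linear BB -> C^o} :=
  HB.pack (ip2 (tens a b) : BB -> C^o) (GRing.isLinear.Build C BB C^o *:%R _ lin).
rewrite -[ip2 _ t]/(F t) {1}[t]tens_expand linear_sum; apply: eq_bigr => i _.
rewrite linear_sum; apply: eq_bigr => j _.
by rewrite linearZ -[RHS]/(_ *: (_ : C^o)); congr (_ *: _); exact: ip2E.
Qed.

Lemma ip2_nondegenerate (t : BB) :
  faithful_state psi -> (forall u, ip2 u t = 0) -> t = 0.
Proof.
move=> psif t0; have bfree := basis_free (vbasisP {:B}).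
apply/matrixP => i j; rewrite mxE.
suff rowt a : \sum_j (\sum_i t i j * ip a (bvec i)) *: bvec j = 0 :> B.
  suff colt j' : \sum_i t i j' *: bvec i = 0 :> B.
    by move/freeP: bfree; apply: (fun H => H (t^~ j) (colt j) i).
  apply: (ip_nondegenerate psif) => a; rewrite ip_sumr.
  by move/freeP: bfree; apply: (fun H => H _ (rowt a) j').
apply: (ip_nondegenerate psif) => b; rewrite ip_sumr -[RHS](t0 (tens a b)).
rewrite ip2_tensl exchange_big; apply: eq_bigr => j' _.
by rewrite mulr_suml; apply: eq_bigr => i' _; rewrite mulrA.
Qed.

Lemma adjmP : faithful_state psi -> is_adjoint ip2 ip mulT mulT_adj.
Proof.
move=> psif; apply: adjoint_exists; [exact: ip2Dr|exact: ip2Dl|exact: ipDr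
  |exact: ipDl|by move=> t; exact: ip2_nondegenerate].
Qed.

Lemma adj1P A : faithful_state psi -> is_adjoint ip ip A (adj A).
Proof.
move=> psif; apply: adjoint_exists; [exact: ipDr|exact: ipDl|exact: ipDr
  |exact: ipDl|by move=> x; exact: ip_nondegenerate].
Qed.

Definition delta_form (delta : R) : Prop :=
  (mulT \o mulT_adj = (delta ^+ 2)%:C *: \1)%VF.

Definition quantum_adjacency (delta : R) (A : 'End(B)) : Prop :=
  (mulT \o (tmap A A \o mulT_adj) = (delta ^+ 2)%:C *: A)%VF.

(* The C*-correspondence B (x)_psi B: left action, right action and B-valued
   inner product on the vector space [BB]. *)
Definition lact (x : B) : 'End(BB) := tlift (fun a b : B => tens (x * a) b).

Definition ract (t : BB) (y : B) : BB :=
  tlift (fun a b : B => tens a (b * y)) t.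

Definition ipB : BB -> BB -> B :=
  tsesq (fun a b c d : B => psi (star a * c) *: (star b * d)).

Lemma lactE x a b : lact x (tens a b) = tens (x * a) b.
Proof.
rewrite /lact tliftE // => [v|u] l y z; apply/matrixP => i j;
  rewrite !mxE /bcoord ?mulrDr -?scalerAr linearP /=.
- by rewrite mulrDl mulrA.
- by rewrite mulrDr mulrCA.
Qed.

Lemma ractE a b y : ract (tens a b) y = tens a (b * y).
Proof.
rewrite /ract tliftE // => [v|u] l x z; apply/matrixP => i j;
  rewrite !mxE /bcoord ?mulrDl -?scalerAl linearP /=.
- by rewrite mulrDl mulrA.
- by rewrite mulrDr mulrCA.
Qed.

Lemma ipBE a b c d : ipB (tens a b) (tens c d) = psi (star a * c) *: (star b * d).
Proof.
rewrite /ipB tsesqE // => [l x y b' c' d'|a' l x y c' d'|a' b' d' l x y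
  |a' b' c' l x y].
- by rewrite -/(ip _ _) ipDl scalerDl scalerA.
- by rewrite starD starZ mulrDl -scalerAl scalerDr !scalerA mulrC.
- by rewrite -/(ip _ _) ipDr scalerDl scalerA.
- by rewrite mulrDr -scalerAr scalerDr !scalerA mulrC.
Qed.

Definition edge_indicator (delta : R) (A : 'End(B)) : BB :=
  ((delta ^+ 2)^-1)%:C *: tmap \1%VF A (mulT_adj 1).

Definition edge_correspondence (delta : R) (A : 'End(B)) : set BB :=
  span_set [set t | exists x y : B,
    t = ract (lact x (edge_indicator delta A)) y].

(* [E] stands for a subcorrespondence of B (x)_psi B. *)
Definition left_kernel (E : set BB) : set B :=
  [set x | forall xi, E xi -> lact x xi = 0].

Definition ip_closed_span (E : set BB) : set B :=
  cnorm_closure (span_set [set b | exists xi eta,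
    [/\ E xi, E eta & b = ipB xi eta]]).

Definition faithful_correspondence (E : set BB) : Prop :=
  forall x y, (forall xi, E xi -> lact x xi = lact y xi) -> x = y.

Definition full_correspondence (E : set BB) : Prop :=
  ip_closed_span E = setT.

End State.
End QuantumGraph.

(* Main.v *)
(* Slicing the first leg of [B (x) B] by [psi (c * _)] separates points, and the
   slice of [m^*(x)] is [c x], so the slice of the edge indicator [eps] is
   [delta^-2 A c]. Hence [x] annihilates the edge correspondence iff [A] vanishes on
   the ideal generated by [x]. Since [A] preserves the involution, the adjacency
   equation gives [<eps, x eps> = delta^-2 A x], so the inner products span
   [B A(B) B]. Every ideal of [B] has the form [z B] for a central projection [z],
   and [A (z B) = 0] iff [z] annihilates the range of [A^*]. *)
Require Import Defs.
From HB Require Import structures.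
From mathcomp Require Import all_boot all_order all_algebra all_field.
From mathcomp Require Import boolp classical_sets reals.
From mathcomp Require Import complex.

Set Implicit Arguments.
Unset Strict Implicit.

Import Order.TTheory GRing.Theory Num.Theory.
Local Open Scope classical_set_scope.
Local Open Scope ring_scope.

(** * Elementary tensors and induction on the tensor product *)

Section TensorLemmas.
Variables (K : fieldType) (U V : vectType K).
Implicit Types (a u : U) (b v : V).

Lemma tens_linl b : linear (fun a : U => tens a b).
Proof.
by move=> k x y; apply/matrixP => i j; rewrite !mxE /bcoord linearP mulrDl mulrA.
Qed.

Lemma tens_linr a : linear (fun b : V => tens a b).
Proof.
by move=> k x y; apply/matrixP => i j; rewrite !mxE /bcoord linearP mulrDr mulrCA.
Qed.

Lemma tens0l b : tens (0 : U) b = 0.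
Proof. by apply/matrixP => i j; rewrite !mxE /bcoord linear0 mul0r. Qed.

Lemma tens_sumr a n (k : 'I_n -> K) (b : 'I_n -> V) :
  \sum_j k j *: tens a (b j) = tens a (\sum_j k j *: b j).
Proof.
elim/big_rec2: _ => [|j t s _ ->]; last by rewrite tens_linr.
by apply/matrixP => i j; rewrite !mxE /bcoord linear0 mulr0.
Qed.

Lemma tens_rows (t : tensor U V) :
  t = \sum_i tens (bvec i) (\sum_j t i j *: bvec j).
Proof.
by rewrite {1}[t]tens_expand; apply: eq_bigr => i _; rewrite tens_sumr.
Qed.

(** Elementary tensors span, and zero is one of them. Identities between linear maps on the tensor
    product reduce through this to elementary tensors. *)
Lemma tensor_ind (P : tensor U V -> Prop) :
  (forall a b, P (tens a b)) ->
  (forall k s t, P s -> P t -> P (k *: s + t)) -> forall t, P t.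
Proof.
move=> Ptens Plin t; have P0 : P 0 by rewrite -(tens0l 0).
have Psum n (F : 'I_n -> tensor U V) : (forall i, P (F i)) -> P (\sum_i F i).
  by move=> PF; elim/big_ind: _ => // x y Px Py; rewrite -[x]scale1r; apply: Plin.
by rewrite [t]tens_rows; apply: Psum => i; apply: Ptens.
Qed.

Lemma tmap_tens (U' V' : vectType K) (f : 'Hom(U, U')) (g : 'Hom(V, V')) a b :
  tmap f g (tens a b) = tens (f a) (g b).
Proof.
rewrite /tmap tliftE // => [v|u] k x y; apply/matrixP => i j;
  rewrite !mxE /bcoord !linearP /=.
- by rewrite mulrDl mulrA.
- by rewrite mulrDr mulrCA.
Qed.

End TensorLemmas.

(** * Involution, positivity and two-sided ideals of [B] *)

Section StarAlgebra.
Variables (R : realType) (B : fdCStarType R).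
Local Notation C := R[i].
Implicit Types (x y z : B) (I : {vspace B}).

Lemma star0 : star (0 : B) = 0.
Proof. by have := starZ 0 (0 : B); rewrite rmorph0 !scale0r. Qed.

Lemma starN x : star (- x) = - star x.
Proof. by rewrite -scaleN1r starZ rmorphN1 scaleN1r. Qed.

Lemma star1 : star (1 : B) = 1.
Proof. by rewrite -[LHS]mulr1 -{2}[1](starK) -starM mulr1 starK. Qed.

Lemma star_sum n (F : 'I_n -> B) : star (\sum_i F i) = \sum_i star (F i).
Proof. by apply: (big_morph _ starD star0). Qed.

(** Elements are complex combinations of self-adjoint ones, and for self-adjoint [h] expanding
    [(h + 1)^2] writes [2 h] as a combination of elements [y^* y]. It serves to show that a map
    commutes with the involution. *)
Lemma conj_linear_positive0 (W : lmodType C) (G : B -> W) :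
  (forall a x y, G (a *: x + y) = a^*%C *: G x + G y) ->
  (forall y, G (star y * y) = 0) -> forall x, G x = 0.
Proof.
move=> Glin Gpos.
have G0 : G 0 = 0 by rewrite -(mulr0 (star 0)) Gpos.
have GZ a x : G (a *: x) = a^*%C *: G x by rewrite -[_ *: x]addr0 Glin G0 addr0.
have GD x y : G (x + y) = G x + G y.
  by rewrite -{1}[x]scale1r Glin rmorph1 scale1r.
have two0 : 2%:R != 0 :> C by rewrite pnatr_eq0.
have Gherm h : star h = h -> G h = 0.
  move=> hh; have := Gpos (h + 1).
  rewrite starD star1 hh mulrDl mulrDr !mul1r mulr1.
  have -> : h * h + h + (h + 1) = star h * h + (2%:R *: h + star 1 * 1).
    by rewrite hh star1 mulr1 scaler_nat mulr2n !addrA.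
  rewrite GD Gpos add0r GD Gpos addr0 GZ rmorph_nat => /eqP.
  by rewrite scaler_eq0 (negPf two0) => /eqP.
(* Both [x + star x] and ['i *: (x - star x)] are self-adjoint. *)
move=> x; have e : 2%:R *: x = (x + star x) + (- 'i%C) *: ('i%C *: (x - star x)).
  rewrite scalerA mulNr -expr2 sqr_i opprK scale1r addrACA subrr addr0.
  by rewrite scaler_nat.
have : G (2%:R *: x) = 0.
  rewrite e GD GZ !Gherm ?scaler0 ?addr0 //.
    have ci : ('i%C)^*%C = - 'i%C :> C by apply/eqP; rewrite eq_complex /= oppr0 !eqxx.
    by rewrite starZ starD starN starK ci scaleNr -scalerN opprB.
  by rewrite starD starK addrC.
rewrite GZ rmorph_nat => /eqP; by rewrite scaler_eq0 (negPf two0) => /eqP.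
Qed.

(** The defect [star (A x) - A (star x)] is conjugate-linear in [x], and complete positivity at
    matrix size 1 makes [A (star y * y)] self-adjoint. *)
Lemma cp_star (A : 'End(B)) x : completely_positive A -> A (star x) = star (A x).
Proof.
move=> cpA; apply/esym/eqP; rewrite -subr_eq0; apply/eqP; move: x.
apply: conj_linear_positive0 => [a x y|y].
  by rewrite !(starD, starZ) !linearP /= starD starZ scalerBr addrACA scalerN.
rewrite starM starK; apply/eqP; rewrite subr_eq0; apply/eqP.
have [|Y /matrixP/(_ ord0 ord0)] := cpA 1%N (const_mx (star y * y)).
  by exists (const_mx y); apply/matrixP => i j; rewrite !mxE big_ord1 !mxE.
by rewrite !mxE big_ord1 !mxE => ->; rewrite starM starK.
Qed.

Section State.
Variables (psi : {scalar B}).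
Hypothesis psi_faithful : faithful_state psi.

(** The defect is conjugate-linear, and it vanishes on positive elements because nonnegative complex
    numbers are real. *)
Lemma state_star x : psi (star x) = (psi x)^*%C.
Proof.
apply/esym/eqP; rewrite -subr_eq0; apply/eqP; move: x.
apply: (@conj_linear_positive0 C^o) => [a x y|y].
  rewrite starD starZ linearP rmorphD rmorphM /= linearP /= opprD addrACA.
  by rewrite -[RHS]/(_ * _ + _) mulrBr.
have [[pos _] _] := psi_faithful.
have : 0 <= psi (star y * y) by apply: pos; exists y.
rewrite starM starK; case: (psi _) => r s; rewrite lecE /= => /andP[/eqP -> _].
by rewrite oppr0 subrr.
Qed.

Lemma starM_eq0 x : star x * x = 0 -> x = 0.
Proof. by move=> x0; apply: psi_faithful.2; rewrite x0 linear0. Qed.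

Lemma ipMl x y z : ip psi (x * y) z = ip psi y (star x * z).
Proof. by rewrite /ip starM mulrA. Qed.

Lemma ip_inj x y : (forall u, ip psi u x = ip psi u y) -> x = y.
Proof.
move=> e; apply/eqP; rewrite -subr_eq0; apply/eqP/(ip_nondegenerate psi_faithful).
by move=> u; rewrite addrC -scaleN1r ipDr e mulN1r addNr.
Qed.

Lemma ip_sym x y : ip psi x y = (ip psi y x)^*%C.
Proof. by rewrite /ip -state_star starM starK. Qed.

Lemma sandwich_ind (V : {vspace B}) (P : B -> Prop) :
  (forall u v w, v \in V -> P (u * v * w)) ->
  (forall k x y, P x -> P y -> P (k *: x + y)) ->
  forall x, x \in ({:B} * V * {:B})%VS -> P x.
Proof.
have prodv_ind (U W : {vspace B}) (Q : B -> Prop) :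
    (forall u w, u \in U -> w \in W -> Q (u * w)) ->
    (forall k x y, Q x -> Q y -> Q (k *: x + y)) ->
    forall x, x \in (U * W)%VS -> Q x.
  move=> Qmul Qlin x; rewrite /prodv unlock => xUW.
  rewrite (coord_span (X := in_tuple _) xUW).
  elim/big_rec: _ => [|i y _ Qy].
    by rewrite -(mul0r 0); apply: Qmul; apply: mem0v.
  apply: Qlin => //.
  have /allpairsP[[u w] /= [uU wW ->]] := mem_nth 0 (ltn_ord i).
  by apply: Qmul; apply: vbasis_mem.
(* The right factor [w] stays general during the inner induction on the left product. *)
move=> Pmul Plin; apply: (prodv_ind) => // p w pUV _; move: p pUV w.
apply: prodv_ind => [u v _ vV w|k x y Px Py w]; first exact: Pmul.
by rewrite mulrDl -scalerAl; apply: Plin.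
Qed.

Lemma memv_sandwich (V : {vspace B}) u v w :
  v \in V -> u * v * w \in ({:B} * V * {:B})%VS.
Proof. by move=> vV; rewrite !memv_mul ?memvf. Qed.

(* The orthogonal projection [z] of [1] onto the ideal is a right unit of it,
   since [x (1 - z)] is both in the ideal and orthogonal to it. An element [y] of
   the ideal that the ideal annihilates from the left has [(y y^* ) y = 0], hence
   vanishes; so [b z = z b z = z b], and [z = z^* z] follows. *)
Lemma ideal_central_projection I :
  (forall b v, v \in I -> b * v \in I) -> (forall b v, v \in I -> v * b \in I) ->
  exists2 z : B, central_projection z & forall x, x \in I <-> z * x = x.
Proof.
move=> Il Ir.
have [z zI zorth] : exists2 z, z \in I & forall x, x \in I -> ip psi x (1 - z) = 0.
  (* The adjoint [g] of the inclusion of [I] is the orthogonal projection onto [I]. *)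
  pose inc : 'Hom(subvs_of I, B) := linfun vsval.
  have := @adjoint_exists R (subvs_of I) B
    (fun u v => ip psi (vsval u) (vsval v)) (ip psi) inc.
  set g := adjoint _ _ _ => gadj.
  exists (vsval (g 1)) => [|x xI]; first exact: subvsP.
  rewrite addrC -scaleN1r ipDr mulN1r.
  have -> : x = vsval (Subvs xI) by [].
  rewrite -gadj ?lfunE ?addNr //= => [v a u w|v a u w|v a u w|v a u w|u u0].
  - by rewrite ipDr.
  - by rewrite ipDl.
  - by rewrite ipDr.
  - by rewrite ipDl.
  - by apply/val_inj/psi_faithful.2/u0.
have xz x : x \in I -> x * z = x.
  move=> xI; apply/esym/eqP; rewrite -subr_eq0 -{1}[x]mulr1 -mulrBr; apply/eqP.
  apply: psi_faithful.2; rewrite -/(ip psi _ _) -[_ * (1 - z)]/(x * (1 - z)).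
  rewrite -[X in ip psi _ (X * _)]starK -ipMl; apply: zorth; apply: Il.
  by rewrite mulrBr mulr1; apply: memvB => //; apply: Ir.
have ann0 y : y \in I -> (forall x, x \in I -> x * y = 0) -> y = 0.
  move=> yI Iy; rewrite -[y]starK; have -> : star y = 0; last exact: star0.
  apply: starM_eq0; rewrite starK; apply: starM_eq0.
  by rewrite starM starK mulrA Iy ?mul0r //; apply: Ir.
have zC b : z * b = b * z.
  rewrite -(xz (z * b)) ?Ir // -mulrA; apply/esym/eqP.
  rewrite -subr_eq0; apply/eqP/ann0.
    by apply: memvB; [exact: Il|apply: Ir].
  by move=> x xI; rewrite mulrBr !mulrA (xz x xI) subrr.
exists z => [|x]; last first.
  by split=> [xI|<-]; [rewrite zC xz|apply: Ir].
have zz : z * z = z by exact: xz.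
suff zsz : z = star z * z by split=> //; rewrite zsz starM starK.
apply/eqP; rewrite -subr_eq0; apply/eqP/starM_eq0.
(* With [w = z - star z * z], all four terms of [star w * w] reduce to [z * star z], since [z] is a
   central idempotent; their signs cancel. *)
rewrite starD starN starM starK mulrBl !mulrBr -!(zC (star z)).
have -> : z * star z * (z * star z) = z * star z.
  by rewrite mulrA -[z * _ * z]mulrA -zC mulrA zz -mulrA -starM zz.
rewrite (_ : star z * (z * star z) = z * star z); last first.
  by rewrite mulrA -zC -mulrA -starM zz.
rewrite (_ : z * star z * z = z * star z); last first.
  by rewrite -mulrA -zC mulrA zz.
by rewrite !subrr.
Qed.

Lemma sandwich_central_projection (V : {vspace B}) :
  exists2 z : B, central_projection z &
    forall x, x \in ({:B} * V * {:B})%VS <-> z * x = x.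
Proof.
apply: ideal_central_projection => b x; move: x; apply: sandwich_ind.
- by move=> u v w vV; rewrite !mulrA memv_sandwich.
- by move=> k x y xI yI; rewrite mulrDr -scalerAr memvD ?memvZ.
- by move=> u v w vV; rewrite -mulrA memv_sandwich.
- by move=> k x y xI yI; rewrite mulrDl -scalerAl memvD ?memvZ.
Qed.

(** The ideal generated by [x] is [z B]. The subspace [W] is left arbitrary so that it can be the
    kernel of [A]. *)
Lemma principal_ideal_projection x : exists z : B,
  [/\ central_projection z, z * x = x &
    forall W : {vspace B}, (forall b c, b * x * c \in W) -> forall b, z * b \in W].
Proof.
have [z zcp zI] := sandwich_central_projection <[x]>%VS; exists z; split=> //.
  by apply/zI; have := memv_sandwich 1 1 (memv_line x); rewrite mul1r mulr1.
move=> W xW b; have /zI : z * (z * b) = z * b by case: zcp => _ zz _; rewrite mulrA zz.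
move: (z * b); apply: sandwich_ind => [u v w /vlineP[k ->]|k s t sW tW].
  by rewrite -scalerAr -scalerAl memvZ.
by rewrite memvD ?memvZ.
Qed.

(** The choice [s = z * a] turns the orthogonality into [ip psi (z * a) (z * a) = 0]. *)
Lemma central_projection_orthogonal z a : central_projection z ->
  (forall s, ip psi a (z * s) = 0) -> z * a = 0.
Proof.
move=> [zs zz _] orth; apply: psi_faithful.2.
by rewrite -/(ip psi _ _) ipMl zs; apply: orth.
Qed.

Lemma central_projectionB z : central_projection z -> central_projection (1 - z).
Proof.
move=> [zs zz zC]; split=> [||b]; first by rewrite starD starN star1 zs.
- by rewrite mulrBl mul1r mulrBr mulr1 zz subrr subr0.
- by rewrite mulrBl mulrBr mul1r mulr1 zC.
Qed.

Lemma ip_adj (A : 'End(B)) x y : ip psi (adj psi A x) y = ip psi x (A y).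
Proof. by rewrite ip_sym -(adj1P A psi_faithful) -ip_sym. Qed.

(** Multiplication by [z] is self-adjoint, so [s |-> A (z * s)] and [a |-> z * adj psi A a] are
    adjoint to each other. *)
Lemma lker_central_projection (A : 'End(B)) z : central_projection z ->
  (forall s, A (z * s) = 0) <-> (forall a, z * adj psi A a = 0).
Proof.
move=> zcp; split=> [Az a|zA s].
  apply: central_projection_orthogonal => // s.
  by rewrite ip_adj Az /ip mulr0 linear0.
apply: ip_inj => u; rewrite -ip_adj.
case: zcp => zs _ _.
by rewrite -{1}zs -ipMl zA /ip star0 mul0r mulr0 linear0.
Qed.

(** For [y] in [S], [x - z * x = (1 - z) * (x - y)], whose norm is arbitrarily small when [x] is in
    the closure. *)
Lemma cnorm_closure_ideal (z : B) (S : set B) :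
  (forall x, S x <-> z * x = x) -> cnorm_closure S = S.
Proof.
move=> Sz; apply/seteqP; split=> x.
  move=> Sx; apply/Sz/esym/eqP; rewrite -subr_eq0; apply/eqP/cnorm0_eq0.
  have cnorm_ge0 (y : B) : 0 <= cnorm y.
    have c0 : cnorm (0 : B) = 0.
      by rewrite -[X in cnorm X](scale0r (0 : B)) cnormZ normr0 mul0r.
    have := cnormD y (- y); rewrite subrr c0 -scaleN1r cnormZ normrN1 mul1r.
    by rewrite -mulr2n pmulrn_lge0.
  apply/eqP; rewrite eq_le cnorm_ge0 andbT; apply/ler_addgt0Pl => e e0; rewrite addr0.
  (* The added 1 keeps the divisor positive when [z = 1]. *)
  have d0 : 0 < cnorm (1 - z) + 1 by rewrite ltr_wpDl.
  have [y /Sz zy /ltW xy] := Sx _ (divr_gt0 e0 d0).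
  have -> : x - z * x = (1 - z) * (x - y).
    by rewrite mulrBl mul1r mulrBr zy opprB addrA subrK.
  apply: le_trans (cnormM _ _) _; rewrite (le_trans (ler_wpM2l _ xy)) //.
  by rewrite mulrCA ger_pMr // ler_pdivrMr // mul1r lerDl.
move=> Sx e e0; exists x => //.
by rewrite subrr -[X in cnorm X](scale0r (0 : B)) cnormZ normr0 mul0r.
Qed.

End State.
End StarAlgebra.

(** * Linear spans of sets *)

Section Span.
Variables (R : realType) (V : vectType R[i]) (S : set V).

Lemma span_set_lin k s t :
  span_set S s -> span_set S t -> span_set S (k *: s + t).
Proof.
move=> [n [c [f [Sf ->]]]] [m [d [g [Sg ->]]]].
exists (n + m)%N, (fun i => match split i with inl j => k * c j | inr j => d j end),
  (fun i => match split i with inl j => f j | inr j => g j end); split.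
  by move=> i; case: (split i).
rewrite big_split_ord /= scaler_sumr; congr (_ + _); apply: eq_bigr => i _.
  by rewrite (unsplitK (inl i)) scalerA.
by rewrite (unsplitK (inr i)).
Qed.

Lemma span_set_mem s : S s -> span_set S s.
Proof.
by move=> Ss; exists 1%N, (fun=> 1), (fun=> s); rewrite big_ord1 scale1r.
Qed.

Lemma span_set_ind (P : V -> Prop) : P 0 -> (forall s, S s -> P s) ->
  (forall k s t, P s -> P t -> P (k *: s + t)) -> forall s, span_set S s -> P s.
Proof.
move=> P0 PS Plin _ [n [c [f [Sf ->]]]].
by elim/big_rec: _ => // i x _ Px; apply: Plin => //; apply: PS.
Qed.

End Span.

(** * Slice maps and the correspondence structure of [B (x) B] *)

Section Slices.
Variables (R : realType) (B : fdCStarType R) (psi : {scalar B}).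
Hypothesis psi_faithful : faithful_state psi.
Local Notation C := R[i].
Local Notation BB := (tensor B B).
Implicit Types (a b c x y : B) (s t : BB) (A : 'End(B)).

(** The contraction of the first leg by [psi (c * _)]; without a star on [c] it is linear in [c]. *)
Definition slice c : 'Hom(BB, B) := tlift (fun a b : B => psi (c * a) *: b).

Lemma sliceE c a b : slice c (tens a b) = psi (c * a) *: b.
Proof.
rewrite /slice tliftE // => [v|u] k x y.
- by rewrite mulrDr -scalerAr linearP scalerDl scalerA.
- by rewrite scalerDr !scalerA mulrC.
Qed.

(** Let [v] be the combination of basis vectors given by column [j] of the difference [r]. The slice
    of [r] at [star v] has [psi (star v * v)] as coordinate [j], so faithfulness gives [v = 0]. *)
Lemma slice_inj s t : (forall c, slice c s = slice c t) -> s = t.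
Proof.
move=> st; apply/eqP; rewrite -subr_eq0; apply/eqP; set r := s - t.
have r0 c : slice c r = 0 by rewrite linearB /= st subrr.
have bfree := basis_free (vbasisP {:B}).
apply/matrixP => i j; rewrite [RHS]mxE.
suff colr : \sum_i r i j *: bvec i = 0 :> B.
  by move/freeP: bfree => /(_ (r^~ j) colr i).
apply: psi_faithful.2; set v := \sum_i _.
have e : \sum_j (psi (star v * \sum_i r i j *: bvec i)) *: bvec j = 0 :> B.
  rewrite -[RHS](r0 (star v)) /slice tliftS exchange_big; apply: eq_bigr => l _ /=.
  rewrite mulr_sumr linear_sum scaler_suml; apply: eq_bigr => k _.
  by rewrite -scalerAr linearZ scalerA.
by move/freeP: bfree => /(_ _ e j).
Qed.

Lemma slice_lact c x t : slice c (lact x t) = slice (c * x) t.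
Proof.
elim/tensor_ind: t => [a b|k s t IHs IHt]; first by rewrite lactE !sliceE mulrA.
by rewrite !linearP /= IHs IHt.
Qed.

Lemma ract_lin y : linear (fun t => ract t y).
Proof. by move=> k s t; rewrite /ract linearP. Qed.

Lemma slice_ract c t y : slice c (ract t y) = slice c t * y.
Proof.
elim/tensor_ind: t => [a b|k s t IHs IHt].
  by rewrite ractE !sliceE scalerAl.
by rewrite ract_lin !linearP /= IHs IHt mulrDl -scalerAl.
Qed.

Lemma slice_tmap A c t : slice c (tmap \1%VF A t) = A (slice c t).
Proof.
elim/tensor_ind: t => [a b|k s t IHs IHt].
  by rewrite tmap_tens !sliceE linearZ id_lfunE.
by rewrite !linearP /= IHs IHt.
Qed.

(** Slicing at [c] is pairing with [tens (star c) d], and the adjoint moves [mulT_adj] to the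
    product [star c * d]. *)
Lemma slice_mulT_adj c x : slice c (mulT_adj psi x) = c * x.
Proof.
apply: (ip_inj psi_faithful) => d.
have -> t : ip psi d (slice c t) = ip2 psi (tens (star c) d) t.
  elim/tensor_ind: t => [a b|k s t IHs IHt].
    by rewrite sliceE ip2E /ip -scalerAr linearZ starK.
  by rewrite linearP ipDr ip2Dr IHs IHt.
by rewrite -adjmP // mulTE ipMl starK.
Qed.

Lemma lactM x y t : lact x (lact y t) = lact (x * y) t.
Proof. by apply: slice_inj => c; rewrite !slice_lact mulrA. Qed.

Lemma lact_ract x t y : lact x (ract t y) = ract (lact x t) y.
Proof. by apply: slice_inj => c; rewrite !(slice_lact, slice_ract). Qed.

Lemma lactB x y t : lact (x - y) t = lact x t - lact y t.
Proof.
elim/tensor_ind: t => [a b|k s t IHs IHt].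
  rewrite !lactE mulrBl -scaleN1r addrC tens_linl.
  by rewrite scaleN1r addrC.
by rewrite !linearP /= IHs IHt scalerDr scalerN addrACA.
Qed.

Lemma ract1 t : ract t 1 = t.
Proof. by apply: slice_inj => c; rewrite slice_ract mulr1. Qed.

Lemma ipB_linl r k s t :
  ipB psi (k *: s + t) r = k^*%C *: ipB psi s r + ipB psi t r.
Proof.
rewrite /ipB /tsesq scaler_sumr -big_split; apply: eq_bigr => i _ /=.
rewrite scaler_sumr -big_split; apply: eq_bigr => j _ /=.
rewrite scaler_sumr -big_split; apply: eq_bigr => m _ /=.
rewrite scaler_sumr -big_split; apply: eq_bigr => l _ /=.
by rewrite !mxE rmorphD rmorphM /= mulrDl scalerDl -mulrA -scalerA.
Qed.

Lemma ipB_linr r : linear (ipB psi r).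
Proof.
move=> k s t.
rewrite /ipB /tsesq scaler_sumr -big_split; apply: eq_bigr => i _ /=.
rewrite scaler_sumr -big_split; apply: eq_bigr => j _ /=.
rewrite scaler_sumr -big_split; apply: eq_bigr => m _ /=.
rewrite scaler_sumr -big_split; apply: eq_bigr => l _ /=.
by rewrite !mxE mulrDr mulrCA -scalerA scalerDl -!scalerA.
Qed.

(** This reduces computations with the [B]-valued inner product to slices. *)
Lemma ipB_tensl a b t : ipB psi (tens a b) t = star b * slice (star a) t.
Proof.
elim/tensor_ind: t => [c d|k s t IHs IHt].
  by rewrite ipBE sliceE scalerAr.
by rewrite ipB_linr IHs IHt linearP mulrDr scalerAr.
Qed.

Lemma ipB_act x y s t :
  ipB psi (ract (lact x s) y) t = star y * ipB psi s (lact (star x) t).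
Proof.
elim/tensor_ind: s => [a b|k s r IHs IHr].
  by rewrite lactE ractE !ipB_tensl slice_lact !starM mulrA.
by rewrite linearP ract_lin !ipB_linl IHs IHr mulrDr scalerAr.
Qed.

Lemma ipB_ract s t y : ipB psi s (ract t y) = ipB psi s t * y.
Proof.
elim/tensor_ind: s => [a b|k s r IHs IHr].
  by rewrite !ipB_tensl slice_ract mulrA.
by rewrite !ipB_linl IHs IHr mulrDl scalerAl.
Qed.

Lemma ipB0l t : ipB psi 0 t = 0.
Proof. by rewrite -(tens0l B (0 : B)) ipB_tensl star0 mul0r. Qed.

Lemma ipB_suml n (F : 'I_n -> BB) t :
  ipB psi (\sum_i F i) t = \sum_i ipB psi (F i) t.
Proof.
elim/big_rec2: _ => [|i r s _ <-]; first exact: ipB0l.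
by rewrite -[F i]scale1r ipB_linl rmorph1 !scale1r.
Qed.

(* Both sides of [sum_i f_i^* (x) (e_i^* x) = m^*(x)] have the slice [c x] at [c],
   where [m^*(1) = sum_i e_i (x) f_i]. *)
Lemma mulT_adj_flip x (f := fun i => \sum_j mulT_adj psi 1 i j *: bvec j) :
  mulT_adj psi x = \sum_i tens (star (f i)) (star (bvec i) * x).
Proof.
(* The slice of [mulT_adj psi 1] at [c] is [c], so [bvec i] and [f i] are dual families for
   [psi]. *)
have fl c : \sum_i psi (c * bvec i) *: f i = c.
  rewrite -[RHS]mulr1 -slice_mulT_adj (tens_rows (mulT_adj psi 1)) linear_sum.
  by apply: eq_bigr => i _; rewrite /= sliceE.
(* The other duality relation follows by pairing with [d] and expanding [star d] by [fl]. *)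
have fr c : \sum_i psi (f i * c) *: bvec i = c.
  apply: (ip_inj psi_faithful) => d; rewrite ip_sumr.
  rewrite /ip -{2}(fl (star d)) mulr_suml linear_sum.
  by apply: eq_bigr => i _; rewrite -scalerAl linearZ mulrC.
apply: slice_inj => c; rewrite slice_mulT_adj linear_sum /=.
(* Applying the involution to the expansion of [star c] expands [c] in the vectors
   [star (bvec i)]. *)
rewrite -[c in LHS]starK -(fr (star c)) star_sum mulr_suml.
apply: eq_bigr => i _; rewrite sliceE starZ scalerAl.
by rewrite -(state_star psi_faithful) starM starK.
Qed.

(** * The edge indicator and the edge correspondence *)

Section Edge.
Variables (delta : R) (A : 'End(B)).
Hypothesis delta_gt0 : 0 < delta.
Local Notation eps := (edge_indicator psi delta A).
Local Notation E := (edge_correspondence psi delta A).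
Local Notation d2 := ((delta ^+ 2)^-1)%:C%C.

Lemma d2_neq0 : d2 != 0 :> C.
Proof.
by rewrite eq_complex /= negb_and invr_eq0 expf_eq0 /= gt_eqF.
Qed.

Lemma slice_edge c : slice c eps = d2 *: A c.
Proof.
by rewrite /edge_indicator linearZ /= slice_tmap slice_mulT_adj mulr1.
Qed.

Lemma edge_gen x y : E (ract (lact x eps) y).
Proof. by apply: span_set_mem; exists x, y. Qed.

(** The slice at [c] of [x y eps] is [d2 *: A (c * x * y)]; slices separate points, and the right
    action only multiplies them on the right. *)
Lemma left_kernelP x : left_kernel E x <-> forall c y, A (c * x * y) = 0.
Proof.
split=> [Kx c y|Ax].
  have := Kx _ (edge_gen y 1); rewrite ract1 lactM => /(congr1 (slice c)).
  rewrite slice_lact slice_edge linear0 mulrA => /eqP.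
  by rewrite scaler_eq0 (negPf d2_neq0) => /eqP.
apply: span_set_ind => [|_ [y [w ->]]|k s t sx tx].
- by rewrite linear0.
- apply: slice_inj => c; rewrite lact_ract lactM slice_ract slice_lact slice_edge.
  by rewrite mulrA Ax scaler0 mul0r linear0.
- by rewrite linearP /= sx tx scaler0 addr0.
Qed.

Lemma faithful_left_kernel :
  faithful_correspondence E <-> forall x, left_kernel E x -> x = 0.
Proof.
split=> [Ef x Kx|Kz x y xy].
  apply: Ef => xi Exi; rewrite Kx //.
  by rewrite -(subrr x) lactB subrr.
apply/eqP; rewrite -subr_eq0; apply/eqP/Kz => xi Exi.
by rewrite lactB xy // subrr.
Qed.

Hypothesis A_adjacency : quantum_adjacency psi delta A.
Hypothesis A_cp : completely_positive A.

Lemma ipB_edge x : ipB psi eps (lact x eps) = d2 *: A x.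
Proof.
pose f i := \sum_j mulT_adj psi 1 i j *: bvec j : B.
have epsE : eps = \sum_i tens (bvec i) (d2 *: A (f i)).
  rewrite /edge_indicator {1}(tens_rows (mulT_adj psi 1)) !linear_sum /=.
  apply: eq_bigr => i _; rewrite tmap_tens id_lfunE.
  apply: slice_inj => c; rewrite linearZ /= !sliceE !scalerA; congr (_ *: _).
  by rewrite mulrC.
have mA : d2 *: mulT B (tmap A A (mulT_adj psi x)) = A x.
  have /lfunP/(_ x) := A_adjacency; rewrite !comp_lfunE scale_lfunE => ->.
  rewrite scalerA -rmorphM mulVf ?rmorph1 ?scale1r //.
  by rewrite expf_neq0 // gt_eqF.
rewrite [X in ipB psi X _]epsE ipB_suml -mA (mulT_adj_flip x) !linear_sum /=.
apply: eq_bigr => i _.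
rewrite ipB_tensl slice_lact slice_edge tmap_tens mulTE starZ.
rewrite (cp_star _ A_cp) -scalerAl -scalerAr; congr (_ *: _).
(* The scalar [d2] is real, so conjugation fixes it. *)
by rewrite [LHS]/conjc /= oppr0.
Qed.

Lemma ipB_edge_gen x y x' y' :
  ipB psi (ract (lact x eps) y) (ract (lact x' eps) y') =
    d2 *: (star y * A (star x * x') * y').
Proof.
by rewrite ipB_act lact_ract ipB_ract lactM ipB_edge mulrA -scalerAr -scalerAl.
Qed.

(** Inner products of generators are multiples of [star y * A (star x * x') * y']. Sesquilinearity
    gives one inclusion, and suitable generators realise each [u * A a * w] for the other. *)
Lemma span_ipB_edge :
  span_set [set b | exists xi eta, [/\ E xi, E eta & b = ipB psi xi eta]] =
    [set` ({:B} * limg A * {:B})%VS].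
Proof.
apply/seteqP; split=> x /=.
  move: x; apply: span_set_ind => [|_ [xi [eta [Exi Eeta ->]]]|k s t sI tI].
  - exact: mem0v.
  - move: xi Exi; apply: span_set_ind => [|_ [y [w ->]]|k s t sI tI].
    + by rewrite ipB0l mem0v.
    + move: eta Eeta; apply: span_set_ind => [|_ [y' [w' ->]]|k s t sI tI].
      * have := ipB_linr (ract (lact y eps) w) (-1) 0 0.
        by rewrite !scaleN1r !addNr => ->; exact: mem0v.
      * by rewrite ipB_edge_gen memvZ // memv_sandwich ?memv_img ?memvf.
      * by rewrite ipB_linr memvD ?memvZ.
    + by rewrite ipB_linl memvD ?memvZ.
  - by rewrite memvD ?memvZ.
apply: sandwich_ind => [u v w /memv_imgP[a _ ->]|k s t]; last exact: span_set_lin.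
have -> : u * A a * w =
    d2^-1 *: ipB psi (ract (lact 1 eps) (star u)) (ract (lact a eps) w) + 0.
  by rewrite ipB_edge_gen scalerA mulVf ?d2_neq0 // scale1r star1 mul1r starK addr0.
apply: span_set_lin.
  apply: span_set_mem; exists (ract (lact 1 eps) (star u)), (ract (lact a eps) w).
  by split=> //; apply: edge_gen.
(* Zero is the empty linear combination. *)
by exists 0%N, (fun=> 0), (fun=> 0); split=> [[]|]; rewrite ?big_ord0.
Qed.

(** The span is an ideal fixed by a central projection, hence already norm closed. *)
Lemma ip_closed_span_edge :
  ip_closed_span psi E = [set` ({:B} * limg A * {:B})%VS].
Proof.
rewrite /ip_closed_span span_ipB_edge.
have [z _ zI] := sandwich_central_projection psi_faithful (limg A).
exact: (cnorm_closure_ideal zI).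
Qed.

End Edge.
End Slices.

(** * Left kernel, range ideal, and the criteria for faithfulness and fullness *)

Unset Implicit Arguments.

Theorem theorem2p9 (R : realType) (B : fdCStarType R) (psi : {scalar B})
    (A : 'End(B)) (delta : R)
    (psi_faithful : faithful_state psi)
    (delta_gt0 : 0 < delta)
    (psi_delta : delta_form psi delta)
    (A_adjacency : quantum_adjacency psi delta A)
    (A_cp : completely_positive A) :
  let E := edge_correspondence psi delta A in
  [/\ left_kernel E =
        orthogonal_set psi [set` ({:B} * limg (adj psi A) * {:B})%VS],
      ip_closed_span psi E = [set` ({:B} * limg A * {:B})%VS],
      faithful_correspondence E <->
        ~ (exists2 S : set B, central_summand S & S `<=` [set` lker A])
    & full_correspondence psi E <->
        ~ (exists2 S : set B, central_summand S &
             forall a s, a \in limg A -> S s -> ip psi a s = 0)].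
Proof.
move=> E.
(* With [proj_K], this describes the left kernel as the union of the ideals [z B] on which [A]
   vanishes. *)
have K_proj x : left_kernel E x -> exists z,
    [/\ central_projection z, z * x = x & forall s, A (z * s) = 0].
  move=> /(left_kernelP psi_faithful A delta_gt0) Ax.
  have [z [zcp zx zW]] := principal_ideal_projection psi_faithful x.
  exists z; split=> // s; apply/eqP; rewrite -memv_ker; apply: zW => b c.
  by rewrite memv_ker Ax.
have proj_K z x : central_projection z -> (forall s, A (z * s) = 0) ->
    z * x = x -> left_kernel E x.
  move=> [_ _ zC] Az zx; apply/(left_kernelP psi_faithful A delta_gt0) => c y.
  by rewrite -zx mulrA -zC -!mulrA Az.
have spanE : ip_closed_span psi E = [set` ({:B} * limg A * {:B})%VS].
  exact: ip_closed_span_edge.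
split=> //.
- apply/seteqP; split=> x /=.
    (* Here [z] kills the range of the adjoint, hence the ideal it generates, and [x = z * x] is
       orthogonal to whatever [z] kills. *)
    move=> /K_proj[z [zcp zx /(lker_central_projection psi_faithful A zcp) zA]].
    move=> y yJ; have zy : z * y = 0.
      move: y yJ; apply: sandwich_ind => [u v w /memv_imgP[a _ ->]|k s t s0 t0].
        by case: zcp => _ _ zC; rewrite !mulrA zC -(mulrA u) zA mulr0 mul0r.
      by rewrite mulrDr -scalerAr s0 t0 scaler0 addr0.
    have [zs _ _] := zcp.
    by rewrite -zx -{1}zs -ipMl zy /ip star0 mul0r linear0.
  (* Conversely the ideal is [p B]. Orthogonality to [p * (p * x)] forces [p * x = 0], so [x] lies
     in [(1 - p) B], where [A] vanishes. *)
  move=> Jx.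
  have [p pcp pJ] := sandwich_central_projection psi_faithful (limg (adj psi A)).
  have [ps pp pC] := pcp.
  have px : p * x = 0.
    apply: psi_faithful.2; rewrite -/(ip psi _ _) -{2}ps -ipMl; apply: Jx.
    by apply/pJ; rewrite !mulrA !pp.
  apply: (proj_K (1 - p)); first exact: central_projectionB.
    apply/(lker_central_projection psi_faithful); first exact: central_projectionB.
    move=> a; rewrite mulrBl mul1r; apply/eqP; rewrite subr_eq0 eq_sym; apply/eqP/pJ.
    by have := memv_sandwich 1 1 (memv_img (adj psi A) (memvf a)); rewrite mul1r mulr1.
  by rewrite mulrBl mul1r px subr0.
(* A summand [z B] inside the kernel of [A] puts [z] itself in the left kernel; conversely a nonzero
   [x] there yields such a summand by [K_proj]. *)
- rewrite faithful_left_kernel //; split=> [K0 [S [z [zcp z0 ->]] zA]|nS x].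
    case/eqP: z0; apply: K0; apply: (proj_K z) => //; last by case: zcp.
    by move=> s; apply/eqP; rewrite -memv_ker; apply: zA; exists s.
  move=> /K_proj[z [zcp zx zA]]; rewrite -zx.
  have [->|z0] := eqVneq z 0; first by rewrite mul0r.
  case: nS; exists [set z * b | b in setT]; first by exists z.
  by move=> _ [b _ <-] /=; rewrite memv_ker zA.
- rewrite /full_correspondence spanE; split=> [full [S [z [zcp z0 ->]] zA]|nS].
    case/eqP: z0; have : 1 \in ({:B} * limg A * {:B})%VS.
      by move/seteqP: full => [_]; apply.
    (* Generalising the unit to any element of the ideal, [z] kills the range of [A] and thus the
       whole ideal, which contains 1. *)
    rewrite -[z]mulr1; move: 1.
    apply: sandwich_ind => [u v w vA|k s t s0 t0].
      have [_ _ zC] := zcp; rewrite !mulrA zC -(mulrA u).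
      rewrite (central_projection_orthogonal psi_faithful (z := z) (a := v)) ?mulr0 ?mul0r //.
      by move=> s; apply: zA => //; exists s.
    by rewrite mulrDr -scalerAr s0 t0 scaler0 addr0.
  (* The ideal is [z B]. Either [z = 1] and it is all of [B], or [(1 - z) B] is a central summand
     orthogonal to the range of [A]. *)
  have [z zcp zI] := sandwich_central_projection psi_faithful (limg A).
  have [z1|z1] := eqVneq (1 - z) 0.
    apply/seteqP; split=> // x _ /=; apply/zI.
    by apply/esym/eqP; rewrite -subr_eq0 -{1}[x]mul1r -mulrBl z1 mul0r.
  case: nS; exists [set (1 - z) * b | b in setT].
    by exists (1 - z); split=> //; exact: central_projectionB.
  move=> a _ aA [b _ <-]; have [zs _ _] := central_projectionB zcp.
  rewrite -{1}zs -ipMl mulrBl mul1r (_ : z * a = a).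
    by rewrite subrr /ip star0 mul0r linear0.
  by apply/zI; have := memv_sandwich 1 1 aA; rewrite mul1r mulr1.
Qed.
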